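(* Let $0<q<1$ and let $n\in\mathbb N$ (positive integer). The following hold. (a) If $h_n(x;q)$ is the discrete $q$-Hermite I polynomial of degree $n$, then $$\int(q^2x^2;q^2)_\infty h_n(x;q)\,d_qx=-q^{n-1}(1-q)(x^2;q^2)_\infty h_{n-1}(\tfrac xq;q).$$ (b) If $p_n(x;a,b;q)$ is the big $q$-Laguerre polynomial of degree $n$, then $$\int\frac{(\frac xa,\frac xb;q)_\infty}{(x;q)_\infty}p_n(x;a,b;q)\,d_qx=\frac{abq^2(1-q)}{(1-aq)(1-bq)}\,\frac{(\frac{x}{aq},\frac{x}{bq};q)_\infty}{(x;q)_\infty}\,p_{n-1}(x;aq,bq;q).$$ (c) If $\alpha>-1$ and $L_n^{\alpha}(x;q)$ is the $q$-Laguerre polynomial of degree $n$, then $$\int\frac{x^\alpha}{(-x;q)_\infty}L_n^{\alpha}(x;q)\,d_qx=\frac{x^{\alpha+1}}{[n]_q(-x;q)_\infty}L_{n-1}^{\alpha+1}(x;q).$$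
   Context: $[n]_q=\frac{1-q^n}{1-q}$; $(a;q)_k=\prod_{j=0}^{k-1}(1-aq^j)$, $(a;q)_\infty=\prod_{j\ge0}(1-aq^j)$, $(a,b;q)_\infty=(a;q)_\infty(b;q)_\infty$. For $x\ne0$, $D_qF(x)=\frac{F(x)-F(qx)}{(1-q)x}$; the indefinite $q$-integral $\int f(x)\,d_qx=F(x)$ means $D_qF(x)=f(x)$ (at all $x\ne0$ where the expressions are defined; $x>0$ in (c)). Definitions, for integers $n\ge0$: $h_n(x;q)=q^{\binom n2}\sum_{k=0}^n\frac{(q^{-n};q)_k(x^{-1};q)_k}{(q;q)_k}(-qx)^k$ (a polynomial in $x$); $p_n(x;a,b;q)={}_3\phi_2(q^{-n},0,x;aq,bq;q,q)=\sum_{k=0}^n\frac{(q^{-n};q)_k(x;q)_k}{(q;q)_k(aq;q)_k(bq;q)_k}q^k$, where $a,b$ are nonzero real parameters for which the denominators do not vanish; $L_n^{\alpha}(x;q)=\frac1{(q;q)_n}{}_2\phi_1(q^{-n},-x;0;q,q^{n+\alpha+1})=\frac1{(q;q)_n}\sum_{k=0}^n\frac{(q^{-n};q)_k(-x;q)_k}{(q;q)_k}q^{k(n+\alpha+1)}$. *)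

(* Defs.v *)
From mathcomp Require Import all_boot all_order all_algebra.
From mathcomp Require Import all_classical all_reals all_analysis.
Set Implicit Arguments.
Unset Strict Implicit.
Unset Printing Implicit Defensive.
Import Order.TTheory GRing.Theory Num.Theory numFieldNormedType.Exports.
Local Open Scope classical_set_scope.
Local Open Scope ring_scope.

Definition qnum (R : realType) (q : R) (n : nat) : R := (1 - q ^+ n) / (1 - q).

(* (a; q)_k *)
Definition qpoch (R : realType) (a q : R) (k : nat) : R :=
  \prod_(j < k) (1 - a * q ^+ j).

(* (a; q)_oo *)
Definition qpochinf (R : realType) (a q : R) : R :=
  limn (fun k => qpoch a q k).

(* (a, b; q)_oo *)
Definition qpochinf2 (R : realType) (a b q : R) : R :=
  qpochinf a q * qpochinf b q.

(* Meaningful for x != 0 only. *)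
Definition qderiv (R : realType) (q : R) (F : R -> R) (x : R) : R :=
  (F x - F (q * x)) / ((1 - q) * x).

(* F is an indefinite q-integral of f: D_q F = f at every nonzero point of A.
   A is meant to be the set where f and D_q F are defined; it has to be given
   because division is total in R. *)
Definition is_qintegral (R : realType) (q : R) (A : set R) (f F : R -> R) :
    Prop :=
  forall x, A x -> x != 0 -> qderiv q F x = f x.

(* The formula is a polynomial in x on x != 0; at x = 0
   (where x^-1 = 0 by convention) it does not give the value of that
   polynomial, but is_qintegral never evaluates it there. *)
Definition qHermite (R : realType) (n : nat) (x q : R) : R :=
  q ^+ 'C(n, 2) *
  \sum_(0 <= k < n.+1)
     qpoch (q ^- n) q k * qpoch x^-1 q k / qpoch q q k * (- q * x) ^+ k.

Definition bigqLaguerre (R : realType) (n : nat) (x a b q : R) : R :=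
  \sum_(0 <= k < n.+1)
     qpoch (q ^- n) q k * qpoch x q k /
     (qpoch q q k * qpoch (a * q) q k * qpoch (b * q) q k) * q ^+ k.

(* alpha is real, so the power of q is a real power. *)
Definition qLaguerre (R : realType) (n : nat) (alpha x q : R) : R :=
  (qpoch q q n)^-1 *
  \sum_(0 <= k < n.+1)
     qpoch (q ^- n) q k * qpoch (- x) q k / qpoch q q k *
     q `^ (k%:R * (n%:R + alpha + 1)).

(* Main.v *)
(* Since (a; q)_oo = (1 - a) (aq; q)_oo, the q-derivative of each right-hand
   side is the weight times a combination of p_{n-1}(x) and p_{n-1}(qx) (in (a),
   of h_{n-1}(x/q) and h_{n-1}(x)), so the theorem reduces to the three backward
   shift identities, which are free of infinite products. Those are checked by
   comparing coefficients in the basis (x; q)_k (resp. x^k (1/x; q)_k and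
   (-x; q)_k), the only input being
     (q^-n; q)_{k+1} = (1 - q^-n) (q^(1-n); q)_k
   and its analogue peeling off the last factor. *)
Require Import Defs.
From mathcomp Require Import all_boot all_order all_algebra.
From mathcomp Require Import all_classical all_reals all_analysis.
From mathcomp Require Import ring lra.
Import Order.TTheory GRing.Theory Num.Theory numFieldNormedType.Exports.
Local Open Scope classical_set_scope.
Local Open Scope ring_scope.

(** * Finite and infinite q-Pochhammer symbols *)

Section QPochhammer.
Variables (R : realType) (q : R).
Hypotheses (q_gt0 : 0 < q) (q_lt1 : q < 1).
Implicit Types (a x : R) (k m n : nat).

Let q_neq0 : q != 0. Proof. exact: lt0r_neq0. Qed.

Lemma qpoch0 a : qpoch a q 0 = 1.
Proof. by rewrite /qpoch big_ord0. Qed.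

Lemma qpochS a k : qpoch a q k.+1 = qpoch a q k * (1 - a * q ^+ k).
Proof. by rewrite /qpoch big_ord_recr. Qed.

Lemma qpochSl a k : qpoch a q k.+1 = (1 - a) * qpoch (a * q) q k.
Proof.
rewrite /qpoch big_ord_recl expr0 mulr1; congr (_ * _).
by apply: eq_bigr => i _; rewrite /= exprS mulrA.
Qed.

Lemma expr_sub1_neq0 k : 1 - q ^+ k.+1 != 0.
Proof. by rewrite subr_eq0 eq_sym lt_eqF // exprn_ilt1 // ltW. Qed.

Lemma qpoch_self_neq0 k : qpoch q q k != 0.
Proof.
elim: k => [|k IHk]; first by rewrite qpoch0 oner_neq0.
by rewrite qpochS -exprS mulf_neq0 // expr_sub1_neq0.
Qed.

(** The last factor is [1 - q^-m q^m]; this kills the boundary term of the telescoping sums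
    below. *)
Lemma qpoch_exprN_eq0 m : qpoch (q ^- m) q m.+1 = 0.
Proof. by rewrite qpochS mulVf ?expf_neq0 // subrr mulr0. Qed.

Lemma qpoch_exprNS m k :
  qpoch (q ^- m.+1) q k.+1 = (1 - q ^- m.+1) * qpoch (q ^- m) q k.
Proof.
by rewrite qpochSl exprS invfM mulrAC mulVf // mul1r.
Qed.

(** The limit is explicit so that the lemma gives both the convergence at [a] and the functional
    equation of [qpochinf]. *)
Lemma cvgn_qpochSl a l :
  qpoch (a * q) q @ \oo --> l -> qpoch a q @ \oo --> (1 - a) * l.
Proof.
move=> cv; rewrite -(cvg_shiftS (qpoch a q)).
rewrite (_ : [sequence _]_n = fun k => (1 - a) * qpoch (a * q) q k).
  by apply: cvgM => //; exact: cvg_cst.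
by apply/funext => k; rewrite /= qpochSl.
Qed.

(** Since [1 + y <= exp y], the product is at most the exponential of a geometric sum, whose
    exponent stays below [-a / (1 - q)]. *)
Lemma qpoch_le_expR a k : a <= 0 ->
  0 <= qpoch a q k <= expR (- a * ((1 - q ^+ k) / (1 - q))).
Proof.
move=> a0; elim: k => [|k /andP[lo hi]].
  by rewrite qpoch0 expr0 subrr mul0r mulr0 expR0 ler01 lexx.
have f0 : 0 <= 1 - a * q ^+ k.
  have : 0 <= - a * q ^+ k by rewrite mulr_ge0 ?oppr_ge0 // exprn_ge0 // ltW.
  by lra.
rewrite qpochS mulr_ge0 //=.
have -> : - a * ((1 - q ^+ k.+1) / (1 - q)) =
    - a * ((1 - q ^+ k) / (1 - q)) + - (a * q ^+ k).
  by rewrite exprS; field; have := expr_sub1_neq0 0; rewrite expr1.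
by rewrite expRD ler_pM // expR_ge1Dx.
Qed.

(** For [a <= 1] the partial products are monotone and bounded: increasing if [a <= 0], decreasing
    and nonnegative otherwise. In general [a q^N <= 1] for some [N], and the first [N] factors are
    peeled off by induction. *)
Lemma cvgn_qpoch a : cvgn (qpoch a q).
Proof.
have qk_le1 k : q ^+ k <= 1 by rewrite exprn_ile1 // ltW.
have qk_ge0 k : 0 <= q ^+ k by rewrite exprn_ge0 // ltW.
have small b : b <= 1 -> cvgn (qpoch b q).
  move=> b1; have [b0|b0] := leP b 0.
    apply: nondecreasing_is_cvgn.
      apply/nondecreasing_seqP => k; rewrite qpochS ler_peMr //.
        by have /andP[] := qpoch_le_expR b k b0.
      by have := qk_ge0 k; nra.
    exists (expR (- b / (1 - q))) => _ [k _ <-].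
    have /andP[_ /le_trans] := qpoch_le_expR b k b0; apply.
    rewrite ler_expR ler_wpM2l ?oppr_ge0 //.
    rewrite ler_pdivrMr ?subr_gt0 // mulVf ?gerBl //.
    by rewrite subr_eq0 eq_sym lt_eqF.
  have f0 k : 0 <= 1 - b * q ^+ k.
    by have := qk_ge0 k; have := qk_le1 k; nra.
  have qp0 k : 0 <= qpoch b q k by rewrite prodr_ge0.
  apply: nonincreasing_is_cvgn.
    apply/nonincreasing_seqP => k; rewrite qpochS ler_piMr //.
    by have := qk_ge0 k; nra.
  by exists 0 => _ [k _ <-].
have [N] : exists N, a * q ^+ N <= 1.
  have : (fun k => a * q ^+ k) @ \oo --> (0 : R).
    apply: (@cvg_geometric R a q).
    by rewrite ger0_norm // ltW.
  move=> /cvgrPdist_le /(_ 1 ltr01) [N _ /(_ N (leqnn N))] /=.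
  rewrite sub0r normrN => aN; exists N.
  exact: le_trans (ler_norm _) aN.
elim: N a => [|N IHN] a; first by rewrite expr0 mulr1; exact: small.
by rewrite exprS mulrA => /IHN /cvg_ex[l /(cvgn_qpochSl a)]; exact: cvgP.
Qed.

Lemma qpochinfS a : qpochinf a q = (1 - a) * qpochinf (a * q) q.
Proof.
by apply: cvg_lim => //; apply: cvgn_qpochSl; exact: cvgn_qpoch.
Qed.

End QPochhammer.

(* Multiplying a basis such as (x; q)_k by x raises k by one; [s] carries the
   part of each term that migrates to the next index. *)
Lemma sum_shift_telescope (V : zmodType) (l r s : nat -> V) (n : nat) :
  r 0%N = s 0%N -> s n = 0 ->
  (forall k, (k < n)%N -> l k = r k.+1 - s k.+1 + s k) ->
  \sum_(0 <= k < n.+1) r k = \sum_(0 <= k < n) l k.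
Proof.
move=> r0 sn0 lE.
suff -> : \sum_(0 <= k < n.+1) r k = \sum_(0 <= k < n) l k + s n.
  by rewrite sn0 addr0.
elim: n lE {sn0} => [|n IHn] lE; first by rewrite big_nat1 big_nil add0r.
rewrite big_nat_recr //= [in RHS]big_nat_recr //= lE //.
rewrite IHn; last by move=> k kn; apply/lE/ltnW.
by rewrite -!addrA; congr (_ + _); rewrite [s n + s _]addrC addKr addrC.
Qed.

(** * Backward shift identities for the three families *)

Section BackwardShift.
Variables (R : realType) (q : R).
Hypotheses (q_gt0 : 0 < q) (q_lt1 : q < 1).
Implicit Types (a b x alpha : R) (k m n : nat).

Let q_neq0 : q != 0. Proof. exact: lt0r_neq0. Qed.

Lemma qHermite_backward_shift m x : x != 0 ->
  x * qHermite m.+1 x q =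
  q ^+ m * (qHermite m x q - (1 - x ^+ 2) * qHermite m (x / q) q).
Proof.
move=> x0; rewrite /qHermite.
(* In this basis [x P_k = P_{k+1} + q^k P_k]. *)
pose P k := qpoch x^-1 q k * x ^+ k.
pose c k := qpoch (q ^- m) q k / qpoch q q k * (-1) ^+ k.
rewrite (sum_shift_telescope _ (fun k => c k * P k * (1 + x - q ^+ k)) _
  (fun k => c k * P k)).
- set S := \sum_(0 <= k < m.+1) _; set S1 := \sum_(0 <= k < m.+1) _.
  set S2 := \sum_(0 <= k < m.+1) _.
  suff e : x * S = S1 - (1 - x ^+ 2) * S2.
    rewrite binS bin1 exprD; transitivity (q ^+ m * q ^+ 'C(m, 2) * (x * S)).
      by ring.
    by rewrite e; ring.
  rewrite /S /S1 /S2 !mulr_sumr -sumrB; apply: eq_bigr => k _.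
  (* Both sides are [x (1/x; q)_{k+1}], with the first or the last factor peeled off. *)
  have e : (x - 1) * qpoch (x / q)^-1 q k = qpoch x^-1 q k * (x - q ^+ k).
    have := qpochSl _ q x^-1 k; rewrite qpochS => /(congr1 (fun t => x * t)).
    rewrite invf_div -[q / x]mulrC => e.
    have -> : (x - 1) = x * (1 - x^-1) by rewrite mulrBr mulr1 divff.
    by rewrite -mulrA -e; field.
  rewrite /c /P [- q * (x / q)](_ : _ = - x); last by field.
  have sgE j : (- q * x) ^+ j = (-1) ^+ j * q ^+ j * x ^+ j.
    by rewrite mulNr exprNn exprMn mulrA.
  rewrite sgE (exprNn x).
  have h : (1 - x ^+ 2) * qpoch (x / q)^-1 q k =
     - (1 + x) * (qpoch x^-1 q k * (x - q ^+ k)) by rewrite -e; ring.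
  have qk0 := qpoch_self_neq0 _ _ q_gt0 q_lt1 k.
  (* A factor [x] comes out because [q^k + (1 + x)(x - q^k) = x (1 + x - q^k)]. *)
  transitivity (qpoch (q ^- m) q k / qpoch q q k * (-1) ^+ k * x ^+ k *
    (q ^+ k * qpoch x^-1 q k - (1 - x ^+ 2) * qpoch (x / q)^-1 q k)).
    by rewrite h; ring.
  by ring.
- by rewrite /c /P !qpoch0 !expr0 !mulr1.
- by rewrite /c qpoch_exprN_eq0 // !mul0r.
- move=> k _; rewrite /c /P qpoch_exprNS // !qpochS.
  have qk0 := qpoch_self_neq0 _ _ q_gt0 q_lt1 k.
  have qk1 := expr_sub1_neq0 _ _ q_gt0 q_lt1 k.
  rewrite mulNr (exprNn (q * x)) exprMn !exprS in qk1 *.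
  by field; rewrite ?qk0 ?qk1 ?x0 ?q_neq0 ?expf_neq0.
Qed.

(** On the right, the coefficient of [(x; q)_k] carries the bracket
    [(aq - x)(bq - x) - abq^2 (1 - x q^k)]. Its constant terms cancel, leaving
    [x (x - aq - bq + abq^2 q^k)]: hence the factor [x] on the left and the last factor of [l]. *)
Lemma bigqLaguerre_backward_shift m x a b : x != 0 -> a != 0 -> b != 0 ->
  (forall k, (k <= m.+1)%N -> qpoch (a * q) q k != 0) ->
  (forall k, (k <= m.+1)%N -> qpoch (b * q) q k != 0) ->
  x * ((1 - a * q) * (1 - b * q)) * bigqLaguerre m.+1 x a b q =
  (a * q - x) * (b * q - x) * bigqLaguerre m x (a * q) (b * q) q -
  a * b * q ^+ 2 * ((1 - x) * bigqLaguerre m (q * x) (a * q) (b * q) q).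
Proof.
move=> x0 a0 b0 ha hb; rewrite /bigqLaguerre.
have a1 : 1 - a * q != 0.
  by have := ha 1%N isT; rewrite qpochS qpoch0 expr0 mulr1 mul1r.
have b1 : 1 - b * q != 0.
  by have := hb 1%N isT; rewrite qpochS qpoch0 expr0 mulr1 mul1r.
pose c k := qpoch (q ^- m) q k /
  (qpoch q q k * qpoch (a * q) q k * qpoch (b * q) q k).
(* [l] keeps only denominators (aq; q)_j, j <= m.+1, known to be nonzero. *)
pose l k := qpoch (q ^- m) q k * qpoch x q k /
  (qpoch q q k * qpoch (a * q) q k.+1 * qpoch (b * q) q k.+1) * q ^+ k *
  (x - a * q - b * q + a * b * q ^+ 2 * q ^+ k).
rewrite (sum_shift_telescope _ l _ (fun k => c k * qpoch x q k)).
- rewrite !mulr_sumr -sumrB; apply: eq_big_nat => k /= km.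
  have qk0 := qpoch_self_neq0 _ _ q_gt0 q_lt1 k.
  have := ha k.+1 km; have := hb k.+1 km.
  rewrite /l !(qpochSl _ q (_ * q) k) !mulf_eq0 !negb_or.
  move=> /andP[_ bk] /andP[_ ak].
  have e : (1 - x) * qpoch (q * x) q k = qpoch x q k * (1 - x * q ^+ k).
    by rewrite [q * x]mulrC -qpochSl qpochS.
  rewrite [X in _ = _ - _ * X](_ : _ =
    qpoch (q ^- m) q k * ((1 - x) * qpoch (q * x) q k) /
    (qpoch q q k * qpoch (a * q * q) q k * qpoch (b * q * q) q k) * q ^+ k);
    last by ring.
  by rewrite e; field; rewrite a1 b1 qk0 ak bk.
- by rewrite /c !qpoch0 expr0 mulr1 mulrAC.
- by rewrite /c qpoch_exprN_eq0 // !mul0r.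
- move=> k km; have := ha k.+1 km; have := hb k.+1 km.
  rewrite /l /c qpoch_exprNS // !qpochS !mulf_eq0 !negb_or.
  move=> /andP[bk bk1] /andP[ak ak1].
  have qk0 := qpoch_self_neq0 _ _ q_gt0 q_lt1 k.
  have qk1 := expr_sub1_neq0 _ _ q_gt0 q_lt1 k.
  rewrite !exprS in qk1 *.
  by field; rewrite ?qk0 ?qk1 ?q_neq0 ?expf_neq0 ?ak ?bk ?ak1 ?bk1.
Qed.

Lemma qLaguerre_backward_shift m alpha x :
  (1 - q ^+ m.+1) * qLaguerre m.+1 alpha x q =
  qLaguerre m (alpha + 1) x q
  - q `^ (alpha + 1) * ((1 + x) * qLaguerre m (alpha + 1) (q * x) q).
Proof.
(* Raising [alpha] by one offsets lowering the degree by one, so all three sums run over powers of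
   the same [t]. *)
rewrite /qLaguerre; set t := q `^ (m.+1%:R + alpha + 1).
have tE k : q `^ (k%:R * (m.+1%:R + alpha + 1)) = t ^+ k.
  by rewrite mulrC powRrM powR_mulrn // powR_ge0.
have tE' k : q `^ (k%:R * (m%:R + (alpha + 1) + 1)) = t ^+ k.
  by rewrite -tE; congr (_ `^ (_ * _)); rewrite -natr1; ring.
have qt : t = q ^+ m.+1 * q `^ (alpha + 1).
  rewrite /t -addrA [LHS]powRD; last by rewrite q_neq0 implybT.
  by rewrite powR_mulrn // ltW.
set Q := q `^ _ in qt *.
pose c k := qpoch (q ^- m) q k / qpoch q q k * t ^+ k.
under eq_bigr do rewrite tE.
under [X in _ = _ * X - _]eq_bigr do rewrite tE'.
under [X in _ = _ - _ * (_ * (_ * X))]eq_bigr do rewrite tE'.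
have qm0 := qpoch_self_neq0 _ _ q_gt0 q_lt1 m.
have qm1 := expr_sub1_neq0 _ _ q_gt0 q_lt1 m.
have qmE : (1 - q ^+ m.+1) * (qpoch q q m.+1)^-1 = (qpoch q q m)^-1.
  by rewrite qpochS -exprS invfM mulrCA divff // mulr1.
rewrite [LHS]mulrA qmE.
rewrite (mulrCA (1 + x)) (mulrCA Q) -mulrBr; congr (_ * _).
rewrite (sum_shift_telescope _
  (fun k => c k * (qpoch (- x) q k - Q * qpoch (- x) q k.+1)) _
  (fun k => c k * qpoch (- x) q k)).
- rewrite !mulr_sumr -sumrB; apply: eq_bigr => k _.
  by rewrite qpochSl /c -mulNr [- x * q]mulNr [x * q]mulrC; ring.
- by rewrite /c !qpoch0 expr0 !mulr1.
- by rewrite /c qpoch_exprN_eq0 // !mul0r.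
- move=> k _; rewrite /c qpoch_exprNS // !qpochS.
  have qk0 := qpoch_self_neq0 _ _ q_gt0 q_lt1 k.
  have qk1 := expr_sub1_neq0 _ _ q_gt0 q_lt1 k.
  (* Only the single [t] split off [t^(k+1)] is expanded: its [q^(m+1)] must meet [1 - q^-(m+1)],
     while [t^k] stays a common factor. *)
  rewrite [t ^+ k.+1]exprS {2 4}qt; rewrite !exprS in qk1 *.
  by field; rewrite ?qk0 ?qk1 ?q_neq0 ?expf_neq0.
Qed.
End BackwardShift.

(** * From backward shifts to q-integrals *)

Theorem theorem3p1 (R : realType) (q : R) (n : nat)
    (q_gt0 : 0 < q) (q_lt1 : q < 1) (n_gt0 : (0 < n)%N) :
  [/\ is_qintegral q setT
        (fun x => qpochinf (q ^+ 2 * x ^+ 2) (q ^+ 2) * qHermite n x q)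
        (fun x => - q ^+ n.-1 * (1 - q) * qpochinf (x ^+ 2) (q ^+ 2)
                  * qHermite n.-1 (x / q) q),
      forall a b : R, a != 0 -> b != 0 ->
        (forall k, (k <= n)%N -> qpoch (a * q) q k != 0) ->
        (forall k, (k <= n)%N -> qpoch (b * q) q k != 0) ->
        is_qintegral q [set x | qpochinf x q != 0]
          (fun x => qpochinf2 (x / a) (x / b) q / qpochinf x q
                    * bigqLaguerre n x a b q)
          (fun x => a * b * q ^+ 2 * (1 - q) / ((1 - a * q) * (1 - b * q))
                    * (qpochinf2 (x / (a * q)) (x / (b * q)) q / qpochinf x q)
                    * bigqLaguerre n.-1 x (a * q) (b * q) q)
    & forall alpha : R, -1 < alpha ->
        is_qintegral q [set x | 0 < x]
          (fun x => x `^ alpha / qpochinf (- x) q * qLaguerre n alpha x q)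
          (fun x => x `^ (alpha + 1) / (qnum q n * qpochinf (- x) q)
                    * qLaguerre n.-1 (alpha + 1) x q)].
Proof.
have q1 : 1 - q != 0 by have := expr_sub1_neq0 _ _ q_gt0 q_lt1 0.
have q0 : q != 0 by exact: lt0r_neq0.
case: n n_gt0 => // m _; split.
- move=> x _ x0; rewrite /qderiv /= [q * x / q]mulrC mulKf //.
  have q2 : q ^+ 2 < 1 by rewrite exprn_ilt1 // ltW.
  rewrite (qpochinfS _ _ (exprn_gt0 2 q_gt0) q2 (x ^+ 2)).
  rewrite exprMn [x ^+ 2 * _]mulrC.
  set w := qpochinf _ _.
  have e := qHermite_backward_shift _ _ q_gt0 q_lt1 m x x0.
  rewrite -[qHermite m.+1 x q](mulKf x0) e.
  by field; rewrite q1 x0.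
- move=> a b a0 b0 ha hb x /= wx x0; rewrite /qderiv /qpochinf2.
  have a1 : 1 - a * q != 0.
    by have := ha 1%N isT; rewrite qpochS qpoch0 expr0 mulr1 mul1r.
  have b1 : 1 - b * q != 0.
    by have := hb 1%N isT; rewrite qpochS qpoch0 expr0 mulr1 mul1r.
  have shift c : c != 0 -> qpochinf (x / (c * q)) q =
      (1 - x / (c * q)) * qpochinf (x / c) q.
    move=> c0; rewrite qpochinfS //; congr (_ * qpochinf _ _).
    by field; rewrite c0 q0.
  have qxc c : c != 0 -> q * x / (c * q) = x / c.
    by move=> c0; field; rewrite c0 q0.
  rewrite !qxc // !shift //.
  have := wx.
  (* Nonvanishing of [(x; q)_oo] passes to [1 - x] and [(qx; q)_oo], so the antiderivative is also
     defined at [qx]. *)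
  rewrite (qpochinfS _ _ q_gt0 q_lt1 x) [x * q]mulrC mulf_eq0 negb_or.
  move=> /andP[x1 wqx].
  have := bigqLaguerre_backward_shift _ _ q_gt0 q_lt1 m x a b x0 a0 b0 ha hb.
  set p := bigqLaguerre m.+1 _ _ _ _ => e.
  have d0 : x * ((1 - a * q) * (1 - b * q)) != 0 by rewrite !mulf_neq0.
  rewrite -[p](mulKf d0) e.
  by field; rewrite q1 q0 x0 a0 b0 a1 b1 x1 wqx.
- move=> alpha alpha_gt x /= x_gt0 x0; rewrite /qderiv /qnum.
  have qm1 := expr_sub1_neq0 _ _ q_gt0 q_lt1 m.
  (* The [q^(alpha + 1)] of the shift identity comes from [(qx)^(alpha + 1)]. *)
  rewrite (powRM _ (ltW q_gt0) (ltW x_gt0)).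
  have xa : x `^ (alpha + 1) = x `^ alpha * x.
    by rewrite powRD ?x0 ?implybT // powRr1 // ltW.
  have x1 : 1 + x != 0 by rewrite lt0r_neq0 // addr_gt0.
  rewrite xa (qpochinfS _ _ q_gt0 q_lt1 (- x)) opprK mulNr [x * q]mulrC.
  have := qLaguerre_backward_shift _ _ q_gt0 q_lt1 m alpha x.
  set L := qLaguerre m.+1 _ _ _ => e.
  (* The inverse of [(-qx; q)_oo] is a common factor of both sides, kept opaque as [w]. *)
  rewrite -[L](mulKf qm1) e !invfM; set w := (qpochinf _ _)^-1.
  by field; rewrite ?q1 ?x1 ?x0 ?qm1.
Qed.
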